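(* For any positive integer $m$, the multiplicity at $\mathbf{1}=(1,1)$ of the bivariate system $f_{m+1,2}(x)=f_{m+2,2}(x)=0$, where $$f_{d,2}(x_1,x_2)=\sum_{k=0}^{d}(-1)^k\binom{d}{k}x_1^{k}x_2^{k^2},$$ is equal to $\binom{m+2}{2}$.
   Context: The multiplicity of an isolated solution of a system of two polynomials in two variables is the complex dimension of the localization at that point of the quotient of the polynomial ring by the ideal they generate. *)

(* Defs.v *)
From HB Require Import structures.
From mathcomp Require Import all_boot all_order all_algebra.
From mathcomp Require Import generic_quotient ring_quotient ring.
From mathcomp Require Import boolp reals complex.
From mathcomp Require Import mpoly.

Set Implicit Arguments.
Unset Strict Implicit.
Unset Printing Implicit Defensive.

Import GRing.Theory Num.Theory.

Local Open Scope ring_scope.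
Local Open Scope quotient_scope.

(* The library equips {ideal_quot I} with a ring structure only. *)
Section QuotientAlgebra.
Variables (K : nzRingType) (A : comAlgType K) (I : idealr A).
Local Notation Q := {ideal_quot I}.
Implicit Types (a b : K) (x y : Q) (s t : A).

Definition qscale a x : Q := \pi_Q (a *: repr x).

Lemma qscale_pi a s : qscale a (\pi_Q s) = \pi_Q (a *: s).
Proof.
have sI : repr (\pi_Q s) - s \in I by rewrite Quotient.idealrBE reprK.
apply/eqP; rewrite /qscale -Quotient.idealrBE -scalerBr -mulr_algl.
exact: idealMr.
Qed.

Fact qscaleA a b x : qscale a (qscale b x) = qscale (a * b) x.
Proof. by elim/quotW: x => s; rewrite (qscale_pi b) !qscale_pi scalerA. Qed.

Fact qscale1 : left_id 1 qscale.
Proof. by elim/quotW=> s; rewrite qscale_pi scale1r. Qed.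

Fact qscaleDr : right_distributive qscale +%R.
Proof.
move=> a; elim/quotW=> s; elim/quotW=> t.
by rewrite -rmorphD !qscale_pi scalerDr rmorphD.
Qed.

Fact qscaleDl x : {morph qscale^~ x : a b / a + b}.
Proof. by elim/quotW: x => s a b; rewrite !qscale_pi scalerDl rmorphD. Qed.

HB.instance Definition _ := GRing.Zmodule_isLmodule.Build K Q
  qscaleA qscale1 qscaleDr qscaleDl.

Lemma pi_scale a s : \pi_Q (a *: s) = a *: \pi_Q s.
Proof. by rewrite /GRing.scale /= qscale_pi. Qed.

Fact qscaleAl a x y : a *: (x * y) = (a *: x) * y.
Proof.
elim/quotW: x => s; elim/quotW: y => t.
by rewrite -rmorphM -!pi_scale -rmorphM scalerAl.
Qed.

HB.instance Definition _ := GRing.Lmodule_isLalgebra.Build K Q qscaleAl.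
HB.instance Definition _ := GRing.Lalgebra_isComAlgebra.Build K Q.
End QuotientAlgebra.

Section Localization.
Variables (A : comNzRingType) (P : prime_idealr A).

Definition loc_denom := {s : A | s \notin (P : {pred A})}.
Definition loc_pair := (A * loc_denom)%type.
HB.instance Definition _ := Choice.on loc_pair.

Implicit Types (a b c : A) (s t u : loc_denom) (x y z : loc_pair).

Definition denom1 : loc_denom :=
  exist (fun a => a \notin (P : {pred A})) 1 (negbT (idealr1 P)).

Fact denomM_subproof s t : sval s * sval t \notin (P : {pred A}).
Proof. by rewrite prime_idealrM negb_or (valP s) (valP t). Qed.

Definition denomM s t : loc_denom :=
  exist (fun a => a \notin (P : {pred A})) _ (denomM_subproof s t).

(* The factor u is needed because A may have zero divisors. *)
Definition loc_equiv : rel loc_pair := fun x y =>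
  `[< exists u : loc_denom,
        sval u * (x.1 * sval y.2) = sval u * (y.1 * sval x.2) >].

Fact loc_equiv_is_equiv : equiv_class_of loc_equiv.
Proof.
split=> [x|x y|y x z].
- by apply/asboolP; exists denom1.
- by apply/asboolP/asboolP=> -[u e]; exists u.
move=> /asboolP[u e] /asboolP[v e']; apply/asboolP.
exists (denomM y.2 (denomM u v)) => /=.
transitivity (sval v * sval z.2 * (sval u * (x.1 * sval y.2))); first by ring.
rewrite e.
transitivity (sval u * sval x.2 * (sval v * (y.1 * sval z.2))); first by ring.
by rewrite e'; ring.
Qed.
Canonical loc_equiv_equiv := EquivRelPack loc_equiv_is_equiv.
Canonical loc_equiv_encModRel := defaultEncModRel loc_equiv.

Definition localization := {eq_quot loc_equiv}.
HB.instance Definition _ : EqQuotient loc_pair loc_equiv localization :=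
  EqQuotient.on localization.
HB.instance Definition _ := Choice.on localization.

Definition loc_frac a s : localization := \pi_localization ((a, s) : loc_pair).

Lemma loc_fracP a s b t :
  loc_frac a s = loc_frac b t <->
  exists u, sval u * (a * sval t) = sval u * (b * sval s).
Proof.
rewrite /loc_frac; split=> [/eqP|[u e]].
  by rewrite piE => /asboolP[u e]; exists u.
by apply/eqP; rewrite piE; apply/asboolP; exists u.
Qed.

Lemma loc_fracE (x : localization) : exists a s, x = loc_frac a s.
Proof.
by exists (repr x).1, (repr x).2; rewrite /loc_frac -surjective_pairing reprK.
Qed.

Definition loc_zero := loc_frac 0 denom1.
Definition loc_one := loc_frac 1 denom1.
Definition loc_opp (x : localization) := loc_frac (- (repr x).1) (repr x).2.
Definition loc_add (x y : localization) :=
  loc_frac ((repr x).1 * sval (repr y).2 + (repr y).1 * sval (repr x).2)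
           (denomM (repr x).2 (repr y).2).
Definition loc_mul (x y : localization) :=
  loc_frac ((repr x).1 * (repr y).1) (denomM (repr x).2 (repr y).2).

Lemma repr_loc_frac a s : exists u,
  sval u * ((repr (loc_frac a s)).1 * sval s) =
  sval u * (a * sval (repr (loc_frac a s)).2).
Proof.
by apply/loc_fracP; rewrite {1}/loc_frac -surjective_pairing reprK.
Qed.

Lemma loc_opp_frac a s : loc_opp (loc_frac a s) = loc_frac (- a) s.
Proof.
have [u e] := repr_loc_frac a s.
by apply/loc_fracP; exists u; rewrite !mulNr !mulrN e.
Qed.

Lemma loc_add_frac a s b t :
  loc_add (loc_frac a s) (loc_frac b t) =
  loc_frac (a * sval t + b * sval s) (denomM s t).
Proof.
have [u e] := repr_loc_frac a s; have [v e'] := repr_loc_frac b t.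
rewrite /loc_add; move: (repr (loc_frac a s)) (repr (loc_frac b t)) e e' => [a' s'] [b' t'] /= e e'.
apply/loc_fracP; exists (denomM u v) => /=.
transitivity (sval v * sval t * sval t' * (sval u * (a' * sval s)) +
              sval u * sval s * sval s' * (sval v * (b' * sval t))); first by ring.
by rewrite e e'; ring.
Qed.

Lemma loc_mul_frac a s b t :
  loc_mul (loc_frac a s) (loc_frac b t) = loc_frac (a * b) (denomM s t).
Proof.
have [u e] := repr_loc_frac a s; have [v e'] := repr_loc_frac b t.
rewrite /loc_mul; move: (repr (loc_frac a s)) (repr (loc_frac b t)) e e' => [a' s'] [b' t'] /= e e'.
apply/loc_fracP; exists (denomM u v) => /=.
transitivity ((sval u * (a' * sval s)) * (sval v * (b' * sval t))); first by ring.
by rewrite e e'; ring.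
Qed.

Fact loc_addA : associative loc_add.
Proof.
move=> x y z; have [a [s ->]] := loc_fracE x; have [b [t ->]] := loc_fracE y.
have [c [u ->]] := loc_fracE z; rewrite !loc_add_frac.
by apply/loc_fracP; exists denom1 => /=; ring.
Qed.

Fact loc_addC : commutative loc_add.
Proof.
move=> x y; have [a [s ->]] := loc_fracE x; have [b [t ->]] := loc_fracE y.
by rewrite !loc_add_frac; apply/loc_fracP; exists denom1 => /=; ring.
Qed.

Fact loc_add0 : left_id loc_zero loc_add.
Proof.
move=> x; have [a [s ->]] := loc_fracE x.
by rewrite loc_add_frac; apply/loc_fracP; exists denom1 => /=; ring.
Qed.

Fact loc_addN : left_inverse loc_zero loc_opp loc_add.
Proof.
move=> x; have [a [s ->]] := loc_fracE x.
rewrite loc_opp_frac loc_add_frac.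
by apply/loc_fracP; exists denom1 => /=; ring.
Qed.

HB.instance Definition _ :=
  GRing.isZmodule.Build localization loc_addA loc_addC loc_add0 loc_addN.

Fact loc_mulA : associative loc_mul.
Proof.
move=> x y z; have [a [s ->]] := loc_fracE x; have [b [t ->]] := loc_fracE y.
have [c [u ->]] := loc_fracE z; rewrite !loc_mul_frac.
by apply/loc_fracP; exists denom1 => /=; ring.
Qed.

Fact loc_mulC : commutative loc_mul.
Proof.
move=> x y; have [a [s ->]] := loc_fracE x; have [b [t ->]] := loc_fracE y.
by rewrite !loc_mul_frac; apply/loc_fracP; exists denom1 => /=; ring.
Qed.

Fact loc_mul1 : left_id loc_one loc_mul.
Proof.
move=> x; have [a [s ->]] := loc_fracE x.
by rewrite loc_mul_frac; apply/loc_fracP; exists denom1 => /=; ring.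
Qed.

Fact loc_mulDl : left_distributive loc_mul +%R.
Proof.
move=> x y z; have [a [s ->]] := loc_fracE x; have [b [t ->]] := loc_fracE y.
have [c [u ->]] := loc_fracE z.
rewrite /GRing.add /= loc_add_frac !loc_mul_frac loc_add_frac.
by apply/loc_fracP; exists denom1 => /=; ring.
Qed.

Fact loc_one_neq0 : loc_one != 0.
Proof.
apply/eqP => /loc_fracP[u]; rewrite /= !mulr1 mulr0 => u0.
by case: u u0 => s sP /= s0; move: sP; rewrite s0 idealr0.
Qed.

HB.instance Definition _ := GRing.Zmodule_isComNzRing.Build localization
  loc_mulA loc_mulC loc_mul1 loc_mulDl loc_one_neq0.

Lemma loc_addE a s b t :
  loc_frac a s + loc_frac b t = loc_frac (a * sval t + b * sval s) (denomM s t).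
Proof. exact: loc_add_frac. Qed.

Lemma loc_mulE a s b t :
  loc_frac a s * loc_frac b t = loc_frac (a * b) (denomM s t).
Proof. exact: loc_mul_frac. Qed.
End Localization.

Section LocalizationAlgebra.
Variables (K : nzRingType) (A : comAlgType K) (P : prime_idealr A).
Local Notation L := (localization P).
Implicit Types (k l : K) (x y : L).

Definition loc_scale k x : L := loc_frac (k *: (repr x).1) (repr x).2.

Lemma loc_scale_frac k a (s : loc_denom P) :
  loc_scale k (loc_frac a s) = loc_frac (k *: a) s.
Proof.
have [u e] := repr_loc_frac a s.
by apply/loc_fracP; exists u; rewrite -!scalerAl -!scalerAr e.
Qed.

Fact loc_scaleA k l x : loc_scale k (loc_scale l x) = loc_scale (k * l) x.
Proof. by have [a [s ->]] := loc_fracE x; rewrite !loc_scale_frac scalerA. Qed.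

Fact loc_scale1 : left_id 1 loc_scale.
Proof.
by move=> x; have [a [s ->]] := loc_fracE x; rewrite loc_scale_frac scale1r.
Qed.

Fact loc_scaleDr : right_distributive loc_scale +%R.
Proof.
move=> k x y; have [a [s ->]] := loc_fracE x; have [b [t ->]] := loc_fracE y.
by rewrite loc_addE !loc_scale_frac loc_addE scalerDr !scalerAl.
Qed.

Fact loc_scaleDl x : {morph loc_scale^~ x : k l / k + l}.
Proof.
move=> k l; have [a [s ->]] := loc_fracE x.
rewrite !loc_scale_frac loc_addE scalerDl; apply/loc_fracP.
by exists (denom1 P) => /=; ring.
Qed.

HB.instance Definition _ := GRing.Zmodule_isLmodule.Build K L
  loc_scaleA loc_scale1 loc_scaleDr loc_scaleDl.

Fact loc_scaleAl k x y : k *: (x * y) = (k *: x) * y.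
Proof.
have [a [s ->]] := loc_fracE x; have [b [t ->]] := loc_fracE y.
by rewrite /GRing.scale /= loc_mulE !loc_scale_frac loc_mulE scalerAl.
Qed.

HB.instance Definition _ := GRing.Lmodule_isLalgebra.Build K L loc_scaleAl.
HB.instance Definition _ := GRing.Lalgebra_isComAlgebra.Build K L.
End LocalizationAlgebra.

(* A plays the role of the polynomial ring and ev that of the evaluation at the
   point considered. *)
Section LocalRing.
Variables (K : fieldType) (A : comAlgType K) (ev : {rmorphism A -> K}).
Variables (f g : A).

Definition common_zero := ev f = 0 /\ ev g = 0.

Definition gen_ideal (z : common_zero) : pred A :=
  fun h => `[< exists a b, h = a * f + b * g >].

Variable z : common_zero.
Local Notation I := (gen_ideal z).

Lemma gen_idealP h : reflect (exists a b, h = a * f + b * g) (h \in I).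
Proof. exact: asboolP. Qed.

(* The hypothesis z is what makes the ideal proper: gen_ideal takes it as an
   argument so that the instance below can be attached to it. *)
Lemma gen_ideal_ev h : h \in I -> ev h = 0.
Proof.
case: z => fp gp /asboolP[a [b ->]].
by rewrite rmorphD !rmorphM fp gp !mulr0 addr0.
Qed.

Fact gen_ideal_closed : idealr_closed I.
Proof.
split.
- by apply/asboolP; exists 0, 0; rewrite !mul0r addr0.
- by apply/negP => /gen_ideal_ev; rewrite rmorph1; apply/eqP/oner_neq0.
move=> c _ _ /asboolP[a [b ->]] /asboolP[a' [b' ->]]; apply/asboolP.
by exists (c * a + a'), (c * b + b'); ring.
Qed.

HB.instance Definition _ := isIdealr.Build A I gen_ideal_closed.

Definition coord_ring := {ideal_quot (I : idealr A)}.
HB.instance Definition _ := GRing.ComAlgebra.on coord_ring.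

(* By gen_ideal_ev the value does not depend on the representative. *)
Definition point_ideal : pred coord_ring := fun x => ev (repr x) == 0.

Lemma point_idealE (h : A) :
  (\pi_{ideal_quot (I : idealr A)} h \in point_ideal) = (ev h == 0).
Proof.
rewrite /point_ideal unfold_in; congr (_ == 0); apply/eqP.
rewrite -subr_eq0 -rmorphB; apply/eqP/gen_ideal_ev.
by rewrite Quotient.idealrBE reprK.
Qed.

Fact point_ideal_closed : idealr_closed point_ideal.
Proof.
split.
- by have := point_idealE 0; rewrite !rmorph0 eqxx => ->.
- by have := point_idealE 1; rewrite !rmorph1 oner_eq0 => ->.
elim/quotW=> a; elim/quotW=> b; elim/quotW=> c; rewrite -rmorphM -rmorphD.
rewrite !point_idealE rmorphD rmorphM => /eqP-> /eqP->.
by rewrite mulr0 addr0.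
Qed.

HB.instance Definition _ :=
  isIdealr.Build coord_ring point_ideal point_ideal_closed.

Fact point_ideal_prime : prime_idealr_closed point_ideal.
Proof.
elim/quotW=> a; elim/quotW=> b; rewrite -rmorphM !point_idealE.
by rewrite rmorphM mulf_eq0.
Qed.

HB.instance Definition _ :=
  isPrimeIdealrClosed.Build coord_ring point_ideal point_ideal_prime.

Definition local_ring := localization (point_ideal : prime_idealr coord_ring).
HB.instance Definition _ := GRing.ComAlgebra.on local_ring.
End LocalRing.

Section Multiplicity.
Variable R : realType.
Local Notation C := R[i].
Implicit Types (f g : {mpoly C[2]}) (p : 'I_2 -> C).

Definition solution f g p := common_zero (meval p) f g.

Definition isolated_solution f g p :=
  solution f g p /\
  exists2 e : C, 0 < e &
    forall q : 'I_2 -> C, (forall i, `|q i - p i| < e) ->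
      solution f g q -> q =1 p.

(* [Vector.axiom n V], a linear bijection from V to 'rV_n, is the library's
   datum witnessing that V is of finite dimension n. *)
Definition multiplicity f g p (n : nat) :=
  isolated_solution f g p /\
  exists z : solution f g p, inhabited (Vector.axiom n (local_ring z)).

Definition fd2 (d : nat) : {mpoly C[2]} :=
  \sum_(k < d.+1)
    ((-1) ^+ k * 'C(d, k)%:R) *: ('X_ord0 ^+ k * 'X_ord_max ^+ (k ^ 2)).
End Multiplicity.

Arguments fd2 : clear implicits.

(* Main.v *)
From HB Require Import structures.
Require Import Defs.
From mathcomp Require Import all_boot all_order all_algebra.
From mathcomp Require Import generic_quotient ring_quotient.
From mathcomp Require Import boolp reals complex mpoly ring zify.

(** Put u = x1 - 1 and v = x2 - 1, and give u weight 1 and v weight 2.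

    Initial forms. In x1^k x2^(k^2) = (1 + u)^k (1 + v)^(k^2) the part of
    weight w is a polynomial of degree at most w in k. Since f_d is, up to sign,
    a d-th finite difference in k at 0, its parts of weight less than d vanish,
    and its part of weight d is (-1)^d h_d, where h_d is d! times the sum of
    u^i v^j / (i! j!) over i + 2j = d (deform_alt_poly). These h_d are Hermite
    polynomials in two variables and satisfy
      h_(d+2) = u h_(d+1) + 2 (d+1) v h_d.

    Graded computation. Modulo v, h_n is u^n, while by the recurrence the ideal
    (h_(n+1), h_(n+2)) is (h_(n+1), v h_n). So statements about the pair
    (h_(n+1), h_(n+2)) follow, by reduction modulo v and division by v, from
    those about (h_n, h_(n+1)). By this induction the only syzygies of
    h_n, h_(n+1) are the trivial ones (herm_syz), and the ideal that they
    generate has the polynomials in u, v of ordinary degree less than n as a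
    complement (stair_herm, stair_span). For n = m + 1 the dimension of this
    complement is binomial(m + 2, 2), and the rest of the proof shows that it is
    also a complement of the ideal (f_n, f_(n+1)) in the local ring.

    Independence. The morphism u |-> uz, v |-> vz^2 to A[z] sends f_n and
    f_(n+1) to z^n F and z^(n+1) G, where F(0) and G(0) are the initial forms.
    The absence of nontrivial syzygies between F(0) and G(0) makes the ideal
    (F, G) saturated with respect to z (saturated). Hence the initial form of
    any element of (f_n, f_(n+1)) lies in (h_n, h_(n+1)), and so does that of
    h p when h is nonzero at the point; if p has degree less than n, it is
    zero (stair_in_ideal).

    Spanning. A weighted homogeneous polynomial of weight w is, modulo
    (f_n, f_(n+1)) and terms of higher weight, of degree less than n; for
    w >= 2n - 1 it is even zero, the weights in degree less than n being at most
    2n - 2 (reduce_homog). Thus each of the n + 1 monomials of weight 2n is,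
    modulo the ideal, a combination of all of them with coefficients vanishing
    at the point, and the determinant trick behind
    Nakayama's lemma gives an h with value 1 at the point that multiplies
    everything of weight more than 2n into (f_n, f_(n+1)) (weight_ge_in_ideal).
    Denominators are inverted by truncated geometric series (stair_fraction).

    Isolatedness. The same h multiplies the powers u^(2n+1) and v^(2n+1) into
    the ideal, so u and v vanish at all common zeros where h does not, in
    particular at those near (1, 1). *)

Set Implicit Arguments.
Unset Strict Implicit.
Unset Printing Implicit Defensive.

Import Order.TTheory GRing.Theory Num.Theory.

Local Open Scope ring_scope.

(** * Finite differences and coefficients of univariate polynomials *)

Section UnivariatePoly.
Variable R : comNzRingType.

(** The identity k C(d+1, k) = (d+1) C(d, k-1) trades one factor k for a
    lower difference, so induction on d only needs (k + 1)^j expanded. *)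
Lemma alt_sum_exp d j : (j <= d)%N ->
  \sum_(k < d.+1) (-1) ^+ k * 'C(d, k)%:R * (k%:R : R) ^+ j =
  if j == d then (-1) ^+ d * d`!%:R else 0.
Proof.
elim: d j => [|d IH] [|j] //.
- by move=> _; rewrite big_ord1 fact0 !mulr1.
- move=> _ /=; transitivity ((1 - 1 : R) ^+ d.+1); last by rewrite subrr expr0n.
  rewrite exprBn.
  by apply: eq_bigr => k _; rewrite expr0 !expr1n !mulr1 mulr_natr.
rewrite ltnS eqSS => jd.
rewrite big_ord_recl /= expr0n mulr0 add0r.
transitivity (- (d.+1%:R) * \sum_(i < j.+1) 'C(j, i)%:R *
   \sum_(k < d.+1) (-1) ^+ k * 'C(d, k)%:R * (k%:R : R) ^+ i).
  under [in RHS]eq_bigr do rewrite mulr_sumr.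
  rewrite exchange_big mulr_sumr; apply: eq_bigr => k _ /=.
  have -> : (-1) ^+ bump 0 k * 'C(d.+1, bump 0 k)%:R * ((bump 0 k)%:R : R) ^+ j.+1
    = - (d.+1%:R) * ((-1) ^+ k * 'C(d, k)%:R * (k%:R + 1) ^+ j).
    rewrite /bump /= add1n !exprS.
    have : (d.+1%:R * 'C(d, k)%:R : R) = k.+1%:R * 'C(d.+1, k.+1)%:R.
      by rewrite -!natrM -mul_bin_diag.
    move=> E.
    transitivity (- (d.+1%:R * 'C(d, k)%:R) * ((-1) ^+ k * (k%:R + 1) ^+ j) : R); last by ring.
    by rewrite E -[k.+1%:R]natr1; ring.
  congr (_ * _); rewrite [_ + 1]addrC exprDn mulr_sumr; apply: eq_bigr => i _.
  rewrite expr1n -mulr_natr; ring.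
rewrite big_ord_recr /= binn mul1r IH // big1 ?add0r => [|i _]; last first.
  by rewrite IH ?(ltn_eqF (leq_trans _ jd)) ?mulr0 // (leq_trans (ltnW _) jd).
by case: (j =P d) jd => [-> _|_ _]; rewrite ?mulr0 // factS natrM exprS; ring.
Qed.

Lemma alt_sum_poly d (P : {poly R}) : (size P <= d.+1)%N ->
  \sum_(k < d.+1) (-1) ^+ k * 'C(d, k)%:R * P.[k%:R] = (-1) ^+ d * d`!%:R * P`_d.
Proof.
move=> sP.
under eq_bigr do rewrite (horner_coef_wide _ sP) mulr_sumr.
rewrite exchange_big big_ord_recr /= big1 ?add0r => [|i _].
  under eq_bigr do rewrite mulrCA.
  by rewrite -mulr_sumr alt_sum_exp // eqxx mulrC.
under eq_bigr do rewrite mulrCA.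
by rewrite -mulr_sumr alt_sum_exp ?(ltnW (ltn_ord _)) // ltn_eqF ?mulr0.
Qed.

Lemma deriv_exp_mul (p : {poly R}) k : (p ^+ k)^`() * p = k%:R * p^`() * p ^+ k.
Proof. by case: k => [|k]; rewrite deriv_exp ?mulr0n ?mul0r // exprS -mulr_natl /=; ring. Qed.

Lemma polyXn_dvd k (p : {poly R}) :
  (forall w, (w < k)%N -> p`_w = 0) -> p = drop_poly k p * 'X^k.
Proof.
move=> p0; rewrite -[LHS](poly_take_drop k) (_ : take_poly _ _ = 0) ?add0r //.
by apply/polyP => w; rewrite coef_take_poly coef0; case: ltnP => // /p0.
Qed.

Lemma coef0_comb (a b c d : R) (p q : {poly R}) :
  (a%:P - b%:P - c%:P * p - d%:P * q)`_0 = a - b - c * p`_0 - d * q`_0.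
Proof. by rewrite !coefB !coefCM !coefC. Qed.

Lemma polyX_dvd (p : {poly R}) : p`_0 = 0 -> exists q, p = q * 'X.
Proof.
by move=> p0; exists (drop_poly 1 p); rewrite -['X]expr1; apply: polyXn_dvd => -[].
Qed.

Lemma coefXderiv (q : {poly R}) w : ('X * q^`())`_w = w%:R * q`_w.
Proof. by case: w => [|w]; rewrite coefXM ?mul0r // coef_deriv /= mulr_natl. Qed.

(** In the recurrence for the coefficients of (1 + uz)^k (1 + vz^2)^(k^2), viewed
    as polynomials in k, only the two leading terms survive in top degree. *)
Lemma coef_step (a b c a' b' c' : R) (P0 P1 P2 : {poly R}) w j :
  (size P0 <= w.+1)%N -> (size P1 <= w)%N -> (size P2 <= w.-1)%N -> (w <= j)%N ->
  ((a%:P * 'X - a'%:P) * P0 + (b%:P * 'X^2 - b'%:P) * P1 +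
    (c%:P * ('X + 2%:P * 'X^2) - c'%:P) * P2)`_j.+1 = a * P0`_j + b * P1`_j.-1.
Proof.
move=> s0 s1 s2 wj; rewrite !(mulrBl, mulrDl, mulrDr) -!mulrA.
rewrite !(coefD, coefB, coefN, coefCM, coefXM, coefXnM) /=.
rewrite (@nth_default _ 0 P0 j.+1) ?(leq_trans s0) //.
rewrite (@nth_default _ 0 P1 j.+1) ?(leq_trans s1) 1?leqW //.
rewrite !(@nth_default _ 0 P2) ?(leq_trans s2) //; try lia.
case: j wj => [|j] wj /=; last by ring.
rewrite (@nth_default _ 0 P1 0) ?(leq_trans s1) //; ring.
Qed.

End UnivariatePoly.

(** * The graded ring and the initial forms *)

Section Graded.
Variable K : numFieldType.
Local Notation A := {mpoly K[2]}.
Implicit Types (p q x y : A) (c : K).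

Local Notation ev := (meval (fun=> 1 : K)).
Definition coord_u : A := 'X_ord0 - 1.
Definition coord_v : A := 'X_ord_max - 1.
Local Notation u := coord_u.
Local Notation v := coord_v.

(** The monomials in u and v span the polynomial ring. *)
Lemma uv_ind (P : A -> Prop) :
  (forall x y, P x -> P y -> P (x + y)) ->
  (forall c x, P x -> P (c *: x)) ->
  (forall i j, P (u ^+ i * v ^+ j)) -> forall x, P x.
Proof.
move=> PD PZ Pm.
have P0 : P 0 by rewrite -(scale0r (u ^+ 0 * v ^+ 0)); apply: PZ.
have uX : 'X_ord0 = 1 + u by rewrite addrC subrK.
have vX : 'X_ord_max = 1 + v by rewrite addrC subrK.
elim/mpolyind => // c m p _ _ Pp; apply/PD/Pp/PZ.
rewrite mpolyXE_id big_ord_recl big_ord1 (_ : lift _ _ = ord_max); last exact/val_inj.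
suff Q a b i j : P ('X_ord0 ^+ a * 'X_ord_max ^+ b * (u ^+ i * v ^+ j)).
  by have := Q (m ord0) (m ord_max) 0 0; rewrite !mulr1.
elim: a i j => [|a IHa] i j; last first.
  rewrite exprS {1}uX.
  have -> : (1 + u) * 'X_ord0 ^+ a * 'X_ord_max ^+ b * (u ^+ i * v ^+ j) =
    'X_ord0 ^+ a * 'X_ord_max ^+ b * (u ^+ i * v ^+ j) +
    'X_ord0 ^+ a * 'X_ord_max ^+ b * (u ^+ i.+1 * v ^+ j) by rewrite exprS; ring.
  by apply: PD; apply: IHa.
rewrite mul1r.
elim: b i j => [|b IHb] i j; first by rewrite mul1r.
rewrite exprS {1}vX.
have -> : (1 + v) * 'X_ord_max ^+ b * (u ^+ i * v ^+ j) =
    'X_ord_max ^+ b * (u ^+ i * v ^+ j) +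
    'X_ord_max ^+ b * (u ^+ i * v ^+ j.+1) by rewrite exprS; ring.
by apply: PD; apply: IHb.
Qed.

Lemma ev_u : ev u = 0.
Proof. by rewrite /coord_u mevalB mevalXU meval1 subrr. Qed.
Lemma ev_v : ev v = 0.
Proof. by rewrite /coord_v mevalB mevalXU meval1 subrr. Qed.

Lemma taylor1 x : exists a b, x = (ev x)%:MP + u * a + v * b.
Proof.
elim/uv_ind: x => [x y [a [b xE]] [a' [b' yE]]|c x [a [b xE]]|i j].
- exists (a + a'), (b + b').
  by rewrite mevalD {1}xE {1}yE mpolyCD; ring.
- exists (c *: a), (c *: b); rewrite mevalZ {1}xE mpolyCM -!mul_mpolyC; ring.
case: i => [|i]; last first.
  exists (u ^+ i * v ^+ j), 0.
  by rewrite mevalM rmorphXn /= ev_u expr0n mul0r mpolyC0 exprS; ring.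
case: j => [|j]; first by exists 0, 0; rewrite mulr1 meval1; ring.
exists 0, (v ^+ j).
by rewrite mevalM [meval _ (v ^+ _)]rmorphXn /= ev_v expr0n mulr0 mpolyC0 exprS; ring.
Qed.

(** Restriction to the line v = 0, followed by the projection onto that line. *)
Definition axis x : A := x \mPo [tuple 'X_ord0; 1].

Lemma axis_u : axis u = u.
Proof. by rewrite /axis /coord_u comp_mpolyB comp_mpolyXU comp_mpoly1. Qed.
Lemma axis_v : axis v = 0.
Proof. by rewrite /axis /coord_v comp_mpolyB comp_mpolyXU comp_mpoly1 subrr. Qed.
Lemma axisM x y : axis (x * y) = axis x * axis y.
Proof. exact: rmorphM. Qed.

Lemma axis_mod x : exists y, x = axis x + v * y.
Proof.
elim/uv_ind: x => [x y [a xE] [b yE]|c x [a xE]|i j].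
- exists (a + b); rewrite /axis comp_mpolyD -!/(axis _) {1}xE {1}yE; ring.
- by exists (c *: a); rewrite /axis comp_mpolyZ -!/(axis _) {1}xE scalerDr scalerAr.
case: j => [|j].
  by exists 0; rewrite mulr1 mulr0 addr0 /axis rmorphXn /= -/(axis _) axis_u.
exists (u ^+ i * v ^+ j).
rewrite axisM [axis (v ^+ _)]rmorphXn /= -/(axis _) axis_v expr0n mulr0 exprS; ring.
Qed.

Lemma u_neq0 : u != 0.
Proof.
apply/eqP => /(congr1 (meval (fun=> 2 : K))) /eqP.
by rewrite /coord_u mevalB mevalXU meval1 meval0 subr_eq0 -subr_eq0 addrK oner_eq0.
Qed.
Lemma v_neq0 : v != 0.
Proof.
apply/eqP => /(congr1 (meval (fun=> 2 : K))) /eqP.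
by rewrite /coord_v mevalB mevalXU meval1 meval0 subr_eq0 -subr_eq0 addrK oner_eq0.
Qed.

(** Restriction to v = 0 kills u x, hence x, its target being a domain in which u
    is nonzero. *)
Lemma v_dvd_uM x y : u * x = v * y -> exists t, x = v * t.
Proof.
move=> /(congr1 axis); rewrite !axisM axis_u axis_v mul0r => /eqP.
rewrite mulf_eq0 (negPf u_neq0) /= => /eqP x0.
by have [t ->] := axis_mod x; exists t; rewrite x0 add0r.
Qed.

(** The Hermite polynomials in two variables: n! times the sum of
    u^i v^j / (i! j!) over i + 2j = n. *)
Fixpoint herm n : A :=
  if n is k.+1 then
    if k is l.+1 then u * herm k + (2 * k)%:R * v * herm l else u
  else 1.

Lemma hermSS n : herm n.+2 = u * herm n.+1 + (2 * n.+1)%:R * v * herm n.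
Proof. by []. Qed.

Lemma herm_mod_v n : exists y, herm n = u ^+ n + v * y.
Proof.
elim/ltn_ind: n => -[|[|n]] IH; try by exists 0; rewrite mulr0 addr0.
have [//|y yE] := IH n.+1.
by exists (u * y + (2 * n.+1)%:R * herm n); rewrite hermSS yE !exprS; ring.
Qed.

Lemma v_dvd_hermM n x y : herm n * x = v * y -> exists t, x = v * t.
Proof.
have [k ->] := herm_mod_v n => E.
have {E} : u ^+ n * x = v * (y - k * x) by rewrite mulrBr -E; ring.
elim: n {k y}(y - _) => [|n IH] y.
  by rewrite mul1r => ->; exists y.
by rewrite exprS -mulrA => /v_dvd_uM[t]; exact: IH.
Qed.

Lemma natr_inv n : (0 < n)%N -> exists k : A, n%:R * k = 1.
Proof.
move=> n0; exists (n%:R^-1)%:MP; rewrite -mpolyC_nat -mpolyCM divff ?mpolyC1 //.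
by rewrite pnatr_eq0 -lt0n.
Qed.

(** Induction on n: by the recurrence, a syzygy of h_(n+1), h_(n+2) is one of
    v h_n, h_(n+1), and v can be cancelled because it is prime to h_(n+1), which
    is u^(n+1) modulo v. *)
Lemma herm_syz n a b : a * herm n + b * herm n.+1 = 0 ->
  exists e, a = herm n.+1 * e /\ b = - herm n * e.
Proof.
elim: n a b => [|n IH] a b.
  rewrite mulr1 => /eqP; rewrite addr_eq0 => /eqP ->.
  by exists (- b); split; rewrite /=; ring.
move=> E.
have [|e [E1 E2]] := IH ((2 * n.+1)%:R * v * b) (a + b * u).
  by rewrite -E hermSS; ring.
have /v_dvd_hermM[t et] : herm n.+1 * e = v * ((2 * n.+1)%:R * b) by rewrite -E1; ring.
have [//|k k2] := @natr_inv (2 * n.+1).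
have bE : b = herm n.+1 * (t * k).
  apply: (mulfI v_neq0); rewrite -[b]mul1r -k2.
  transitivity (k * ((2 * n.+1)%:R * v * b)); first by ring.
  by rewrite E1 et; ring.
exists (- (t * k)); split; last by rewrite mulrNN.
have eE : e = (2 * n.+1)%:R * v * (t * k).
  by rewrite et -[t in LHS]mulr1 -[X in v * (t * X)]k2; ring.
apply: (addIr (b * u)); rewrite E2 eE bE hermSS; ring.
Qed.

Fixpoint tri_num n := if n is k.+1 then (k.+1 + tri_num k)%N else 0%N.

Lemma tri_numE n : tri_num n = 'C(n.+1, 2).
Proof. by elim: n => // n IH; rewrite [tri_num _]/= IH [RHS]binS bin1 addnC. Qed.

(** The polynomials in u, v of degree less than n, with coordinates. A
    polynomial of degree at most k is a polynomial in u of degree at most k plus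
    v times a polynomial of degree less than k; this is the decomposition along
    which the arguments by reduction modulo v proceed. *)
Fixpoint stair n : 'rV[K]_(tri_num n) -> A :=
  if n is k.+1 then fun s : 'rV_(k.+1 + tri_num k) =>
    \sum_(i < k.+1) lsubmx s 0 i *: u ^+ i + v * stair (rsubmx s)
  else fun=> 0.

Lemma stairS n (r : 'rV_n.+1) (s : 'rV_(tri_num n)) :
  stair (row_mx r s : 'rV_(tri_num n.+1)) = \sum_(i < n.+1) r 0 i *: u ^+ i + v * stair s.
Proof. by rewrite /= row_mxKl row_mxKr. Qed.

Lemma stair_linear n : linear (@stair n).
Proof.
move=> c; elim: n => [|n IH] s t /=; first by rewrite scaler0 addr0.
rewrite !linearP /= IH scalerDr scaler_sumr addrACA -big_split /=; congr (_ + _).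
  by apply: eq_bigr => i _; rewrite !mxE scalerDl scalerA.
by rewrite mulrDr scalerAr.
Qed.

Lemma stair0 n : stair (0 : 'rV_(tri_num n)) = 0.
Proof. by have := stair_linear (-1) (0 : 'rV_(tri_num n)) 0; rewrite scaler0 addr0 scaleN1r addNr. Qed.

(** The coefficients can be peeled off one by one: the constant one vanishes by
    evaluation at the point, and then u can be cancelled modulo v. *)
Lemma row_u_mod_v n (r : nat -> K) x y :
  \sum_(i < n) r i *: u ^+ i + u ^+ n * x = v * y ->
  (forall i, (i < n)%N -> r i = 0) /\ exists t, x = v * t.
Proof.
elim: n r y => [|n IH] r y.
  by rewrite big_ord0 add0r mul1r => ->; split; [|exists y].
rewrite big_ord_recl /= => E.
have r00 : r 0%N = 0.
  move/(congr1 ev): E; rewrite !mevalD mevalZ expr0 meval1 mulr1 exprS -mulrA !mevalM.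
  rewrite ev_u ev_v !mul0r addr0 (raddf_sum (meval _)) /= big1 => [|i _]; last first.
    by rewrite mevalZ exprS mevalM ev_u mul0r mulr0.
  by rewrite addr0.
have {E} : u * (\sum_(i < n) r i.+1 *: u ^+ i + u ^+ n * x) = v * y.
  rewrite -E r00 scale0r add0r mulrDr mulrA -exprS mulr_sumr; congr (_ + _).
  by apply: eq_bigr => i _; rewrite -scalerAr -exprS.
move=> /v_dvd_uM[t] /(IH (fun i => r i.+1))[rS ?]; split=> //.
by case.
Qed.

(** Together with stair_span: the polynomials of degree less than n form a
    complement of the ideal (h_n, h_(n+1)). Modulo v the hypothesis says that a
    polynomial in u of degree at most n is a multiple of u^(n+1), so it is zero
    and the coefficient a + b u is divisible by v; dividing by v leads to h_n,
    h_(n+1). *)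
Lemma stair_herm n (s : 'rV_(tri_num n)) a b : stair s = a * herm n + b * herm n.+1 -> s = 0.
Proof.
elim: n s a b => [|n IH] s a b; first by move=> _; apply/rowP; case.
rewrite -[s](@hsubmxK _ 1 n.+1 (tri_num n)); move: {+}(lsubmx _) {+}(rsubmx _) => r {}s.
rewrite stairS => E.
have [k kE] := herm_mod_v n.+1.
have /(@row_u_mod_v _ (fun i => r 0 (inord i)))[rE [t tE]] :
  \sum_(i < n.+1) r 0 (inord i) *: u ^+ i + u ^+ n.+1 * (- (a + b * u)) =
   v * ((a + b * u) * k + (2 * n.+1)%:R * b * herm n - stair s).
  under eq_bigr do rewrite inord_val.
  by rewrite -[X in X + _](addrK (v * stair s)) E hermSS kE; ring.
have r0 : r = 0 by apply/rowP => i; rewrite mxE -(rE i) ?inord_val.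
have ev' : v * stair s = v * ((2 * n.+1)%:R * b * herm n + (- t) * herm n.+1).
  have : v * stair s = a * herm n.+1 + b * herm n.+2.
    by rewrite -E r0 big1 ?add0r // => i _; rewrite mxE scale0r.
  move=> ->.
  have -> : a = - (v * t) - b * u by rewrite -tE; ring.
  rewrite hermSS; ring.
by rewrite r0 (IH _ _ _ (mulfI v_neq0 ev')) row_mx0.
Qed.

Lemma row_u_span n x : exists (r : 'rV[K]_n) q y,
  x = \sum_(i < n) r 0 i *: u ^+ i + u ^+ n * q + v * y.
Proof.
elim: n => [|n [r [q [y xE]]]].
  by exists 0, x, 0; rewrite big_ord0; ring.
have [a [b qE]] := taylor1 q.
exists (\row_i (if unlift ord_max i is Some j then r 0 j else ev q)), a, (y + u ^+ n * b).
rewrite big_ord_recr /= mxE unlift_none.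
rewrite (eq_bigr (fun i => r 0 i *: u ^+ i)) => [|i _]; last first.
  rewrite mxE (_ : widen_ord _ i = lift ord_max i) ?liftK //.
  by apply: val_inj; rewrite /= /bump leqNgt ltn_ord.
by rewrite {1}xE {1}qE -mul_mpolyC exprSr; ring.
Qed.

(** Divide x by u^(n+1) modulo v, replace u^(n+1) by h_(n+1), and apply the
    induction hypothesis to the quotient by v; v h_n is a combination of
    h_(n+1) and h_(n+2) by the recurrence. *)
Lemma stair_span n x : exists (s : 'rV[K]_(tri_num n)) a b,
  x = stair s + a * herm n + b * herm n.+1.
Proof.
elim: n x => [|n IH] x; first by exists 0, x, 0; rewrite /=; ring.
have [r [q [y xE]]] := row_u_span n.+1 x.
have [k kE] := herm_mod_v n.+1.
have [s [a [b yE]]] := IH (y - k * q).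
have [//|l l2] := @natr_inv (2 * n.+1).
exists (row_mx r s), (q + v * b - u * (a * l)), (a * l).
rewrite stairS {1}xE hermSS.
transitivity (\sum_(i < n.+1) r 0 i *: u ^+ i + q * herm n.+1 + v * (y - k * q)).
  by rewrite kE; ring.
rewrite yE.
transitivity (\sum_(i < n.+1) r 0 i *: u ^+ i + q * herm n.+1 +
  v * (stair s + a * ((2 * n.+1)%:R * l) * herm n + b * herm n.+1)).
  by rewrite l2 mulr1.
ring.
Qed.

End Graded.

(** * The weight deformation *)

Section Deform.
Variable K : numFieldType.
Local Notation A := {mpoly K[2]}.
Implicit Types (p q x y : A) (c : K).
Local Notation ev := (meval (fun=> 1 : K)).
Local Notation u := (coord_u K).
Local Notation v := (coord_v K).

(** Keeps conversion from unfolding the morphism below. *)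
Fact deform_key : unit. Proof. exact: tt. Qed.
(** The morphism u |-> uz, v |-> vz^2, with z the variable of {poly A}: the
    coefficient of z^w in the image of x is the part of weight w of x,
    and x is weighted homogeneous of weight w when its image is x z^w. *)
Definition deform : A -> {poly A} := locked_with deform_key
  (mmap (polyC \o @mpolyC 2 K)
    (fun i => if i == ord0 then 1 + u%:P * 'X else 1 + v%:P * 'X^2)).

Fact deform_is_zmod_morphism : zmod_morphism deform.
Proof. by rewrite /deform unlock; exact: rmorphB. Qed.
Fact deform_is_monoid_morphism : monoid_morphism deform.
Proof. by rewrite /deform unlock; split; [exact: rmorph1|exact: rmorphM]. Qed.
HB.instance Definition _ :=
  GRing.isZmodMorphism.Build A {poly A} deform deform_is_zmod_morphism.
HB.instance Definition _ :=
  GRing.isMonoidMorphism.Build A {poly A} deform deform_is_monoid_morphism.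

Lemma deformX0 : deform 'X_ord0 = 1 + u%:P * 'X.
Proof. by rewrite /deform unlock mmapX mmap1U. Qed.
Lemma deformX1 : deform 'X_ord_max = 1 + v%:P * 'X^2.
Proof. by rewrite /deform unlock mmapX mmap1U. Qed.
Lemma deformD x y : deform (x + y) = deform x + deform y.
Proof. exact: rmorphD. Qed.
Lemma deformB x y : deform (x - y) = deform x - deform y.
Proof. exact: rmorphB. Qed.
Lemma deformM x y : deform (x * y) = deform x * deform y.
Proof. exact: rmorphM. Qed.
Lemma deformZ c x : deform (c *: x) = (c%:MP)%:P * deform x.
Proof. by rewrite /deform unlock mmapZ. Qed.
Lemma deform_u : deform u = u%:P * 'X.
Proof. by rewrite {1}/coord_u rmorphB rmorph1 /= deformX0 addrC addKr. Qed.
Lemma deform_v : deform v = v%:P * 'X^2.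
Proof. by rewrite {1}/coord_v rmorphB rmorph1 /= deformX1 addrC addKr. Qed.
Lemma deform_mon i j : deform (u ^+ i * v ^+ j) = (u ^+ i * v ^+ j)%:P * 'X^(i + 2 * j).
Proof.
rewrite rmorphM !rmorphXn /= deform_u deform_v !exprMn polyCM !rmorphXn /=.
by rewrite exprD exprM ['X^2]expr2 exprMn; ring.
Qed.

Lemma deform_exp_u i : deform (u ^+ i) = (u ^+ i)%:P * 'X^i.
Proof. by have := deform_mon i 0; rewrite mulr1 addn0. Qed.

Lemma deform_at1 x : (deform x).[1] = x.
Proof.
elim/(@uv_ind K): x => [x y Ex Ey|c x Ex|i j].
- by rewrite deformD hornerD Ex Ey.
- by rewrite deformZ hornerM hornerC Ex mul_mpolyC.
by rewrite deform_mon hornerM hornerC hornerXn expr1n mulr1.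
Qed.

Lemma deform_coef x w : deform (deform x)`_w = ((deform x)`_w)%:P * 'X^w.
Proof.
elim/(@uv_ind K): x => [x y Ex Ey|c x Ex|i j].
- by rewrite deformD coefD deformD polyCD Ex Ey mulrDl.
- by rewrite deformZ coefCM mul_mpolyC deformZ Ex -mul_mpolyC polyCM mulrA.
rewrite deform_mon coefCM coefXn; case: eqP => [->|_]; last by rewrite mulr0 !rmorph0 mul0r.
by rewrite mulr1 deform_mon.
Qed.

Lemma deform_coef0 x : (deform x)`_0 = (ev x)%:MP.
Proof.
elim/(@uv_ind K): x => [x y Ex Ey|c x Ex|i j].
- by rewrite deformD coefD Ex Ey mevalD mpolyCD.
- by rewrite deformZ coefCM Ex mevalZ mpolyCM.
rewrite deform_mon coefCM coefXn mevalM !rmorphXn /= ev_u ev_v.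
by case: i j => [|i] [|j]; rewrite ?expr0n ?mul0r ?mulr0 ?mulr1 ?mpolyC0 ?mpolyC1.
Qed.

Lemma deform_herm n : deform (herm K n) = (herm K n)%:P * 'X^n.
Proof.
elim/ltn_ind: n => -[|[|n]] IH; first by rewrite rmorph1 mulr1.
  exact: deform_u.
rewrite hermSS deformD !deformM rmorph_nat !IH // deform_u deform_v.
by rewrite [in RHS]polyCD ![in RHS]polyCM [in RHS]polyC_natr !exprS; ring.
Qed.

(** Degree less than n is inherited by the weighted homogeneous parts, and the
    weights that occur are at most 2n - 2. *)
Lemma deform_stair n (s : 'rV[K]_(tri_num n)) w :
  exists2 t : 'rV[K]_(tri_num n), (deform (stair s))`_w = stair t &
    (2 * n <= w.+1)%N -> t = 0.
Proof.
elim: n s w => [|n IH] s w; first by exists 0; rewrite //= rmorph0 coef0.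
rewrite -[s](@hsubmxK _ 1 n.+1 (tri_num n)); move: {+}(lsubmx _) {+}(rsubmx _) => r {}s.
have [t Et t0] : exists2 t : 'rV[K]_(tri_num n), (deform (v * stair s))`_w = v * stair t &
    (2 * n.+1 <= w.+1)%N -> t = 0.
  rewrite deformM deform_v -mulrA coefCM coefXnM.
  case: ltnP => w2.
    by exists 0; rewrite ?mulr0 // (_ : stair 0 = 0) ?mulr0 //; exact: stair0.
  have [t -> t0] := IH s (w - 2)%N; exists t => // nw.
  by apply: t0; rewrite mulnS in nw; rewrite -subSn // leq_subRL // (leq_trans w2).
exists (row_mx (\row_i if i == w :> nat then r 0 i else 0) t).
  rewrite !stairS rmorphD coefD Et; congr (_ + _).
  rewrite rmorph_sum coef_sum; apply: eq_bigr => i _.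
  rewrite mxE /= deformZ deform_exp_u coefCM coefCM coefXn [w == _]eq_sym.
  by case: eqP => _; rewrite ?mulr1 ?mulr0 ?scale0r ?mul_mpolyC.
move=> nw; rewrite t0 // (_ : \row_i _ = 0) ?row_mx0 //.
apply/rowP => i; rewrite !mxE ltn_eqF //.
by have := ltn_ord i; lia.
Qed.

End Deform.

(** * Initial forms of the polynomials of the system *)

Section Initial.
Variable K : numFieldType.
Local Notation A := {mpoly K[2]}.
Implicit Types (p q x y : A) (c : K).
Local Notation ev := (meval (fun=> 1 : K)).
Local Notation u := (coord_u K).
Local Notation v := (coord_v K).

(** The deformation of x1^k x2^(k^2). *)
Definition term k : {poly A} := (1 + u%:P * 'X) ^+ k * (1 + v%:P * 'X^2) ^+ (k ^ 2).

(** The logarithmic derivative of (1 + uz)^k (1 + vz^2)^(k^2), with the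
    denominator (1 + uz)(1 + vz^2) multiplied out. The derivatives of the term
    times a power of z are arranged so that each summand has an immediate
    coefficient. *)
Lemma term_deriv k : (term k)^`() =
   (k%:R * u)%:P * term k - u%:P * ('X * (term k)^`())
   + (2 * k%:R ^+ 2 * v)%:P * ('X * term k)
   - v%:P * ('X * ('X * term k)^`() - 'X * term k)
   + ((k%:R + 2 * k%:R ^+ 2) * u * v)%:P * ('X^2 * term k)
   - (u * v)%:P * ('X * ('X^2 * term k)^`() - 2%:P * ('X^2 * term k)).
Proof.
have E : (term k)^`() * ((1 + u%:P * 'X) * (1 + v%:P * 'X^2)) =
  (k%:R * u%:P * (1 + v%:P * 'X^2) + 2 * k%:R ^+ 2 * v%:P * 'X * (1 + u%:P * 'X)) * term k.
  set a := 1 + u%:P * 'X; set b := 1 + v%:P * 'X^2.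
  rewrite /term derivM -/a -/b.
  transitivity ((a ^+ k)^`() * a * b ^+ (k ^ 2) * b + a ^+ k * ((b ^+ (k ^ 2))^`() * b) * a).
    by ring.
  rewrite !deriv_exp_mul natrX.
  have -> : a^`() = u%:P by rewrite /a derivD derivC add0r derivM derivC derivX; ring.
  have -> : b^`() = 2 * v%:P * 'X.
    by rewrite /b derivD derivC add0r derivM !derivE; ring.
  by ring.
move: (term k) E => L E.
rewrite !derivM !derivX ![(_ * u)%:P]polyCM ![(_ * v)%:P]polyCM ![(_ * u)%:P]polyCM.
rewrite [(k%:R + _)%:P]polyCD ![(2 * _)%:P]polyCM ![(_ ^+ 2)%:P]rmorphXn /= !polyC_natr.
apply/eqP; rewrite -subr_eq0; apply/eqP.
transitivity (L^`() * ((1 + u%:P * 'X) * (1 + v%:P * 'X^2)) -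
  (k%:R * u%:P * (1 + v%:P * 'X^2) +
   2 * k%:R ^+ 2 * v%:P * 'X * (1 + u%:P * 'X)) * L); first by ring.
by rewrite E subrr.
Qed.

(** Comparing coefficients in the differential equation term_deriv expresses
    (w + 1) times the coefficient of z^(w+1) by the three preceding ones; its
    leading part as a polynomial in k is the recurrence that defines herm. *)
Lemma term_coef w : exists P : {poly A},
  [/\ (size P <= w.+1)%N, w`!%:R * P`_w = herm K w & forall k, (term k)`_w = P.[k%:R]].
Proof.
elim/ltn_ind: w => -[_|w IH].
  exists 1; split=> [||k]; rewrite ?size_poly1 // ?fact0 ?coefC ?mul1r //.
  rewrite hornerC /term -!horner_coef0 hornerM !horner_exp !hornerD !hornerM !hornerC !hornerX.
  by rewrite !mulr0 !addr0 !expr1n mulr1.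
have [//|P0 [s0 l0 e0]] := IH w.
(* P1 and P2 give the coefficients of indices w - 1 and w - 2, read as those of
   z^w in z and z^2 times the term so that small w needs no separate treatment. *)
have [P1 [s1 l1 e1]] : exists P : {poly A}, [/\ (size P <= w)%N,
    w`!%:R * P`_(w.-1) = w%:R * herm K w.-1 & forall k, ('X * term k)`_w = P.[k%:R]].
  case: w {P0 s0 l0 e0} IH => [_|w IH].
    exists 0; split=> [||k]; rewrite ?size_poly0 ?coef0 ?mulr0 ?mul0r //.
    by rewrite horner0 coefXM.
  have [|P [sP lP eP]] := IH w; first lia.
  exists P; split=> [//||k]; last by rewrite coefXM eP.
  by rewrite factS natrM -mulrA lP.
have [P2 [s2 e2]] : exists P : {poly A}, (size P <= w.-1)%N /\
    forall k, ('X^2 * term k)`_w = P.[k%:R].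
  case: w {P0 s0 l0 e0 P1 s1 l1 e1} IH => [|[|w]] IH.
  - by exists 0; split=> [|k]; rewrite ?size_poly0 ?horner0 ?coefXnM.
  - by exists 0; split=> [|k]; rewrite ?size_poly0 ?horner0 ?coefXnM.
  have [|P [sP _ eP]] := IH w; first lia.
  by exists P; split=> // k; rewrite coefXnM /= subn2 eP.
have [//|i iE] := @natr_inv K w.+1.
pose Q := i%:P * ((u%:P * 'X - (w%:R * u)%:P) * P0 + ((2 * v)%:P * 'X^2 - ((w%:R - 1) * v)%:P) * P1
   + ((u * v)%:P * ('X + 2%:P * 'X^2) - ((w%:R - 2) * u * v)%:P) * P2).
have QE j : (w <= j)%N -> Q`_j.+1 = i * (u * P0`_j + 2 * v * P1`_j.-1).
  by move=> wj; rewrite coefCM (coef_step _ _ _ _ _ _ s0 s1 s2 wj).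
exists Q; split.
- apply/leq_sizeP => -[|j] // wj; rewrite QE; last lia.
  rewrite (@nth_default _ 0 P0 j); last exact: leq_trans s0 _.
  rewrite (@nth_default _ 0 P1 j.-1); last by apply: leq_trans s1 _; case: j wj.
  by rewrite !mulr0 addr0 mulr0.
- rewrite QE // factS natrM.
  transitivity (w.+1%:R * i * (u * (w`!%:R * P0`_w) + 2 * v * (w`!%:R * P1`_w.-1))).
    by ring.
  rewrite iE mul1r.
  by rewrite l0 l1; case: w {P0 s0 l0 e0 P1 s1 l1 e1 P2 s2 e2 Q QE i iE IH} => [|w];
    rewrite ?hermSS ?natrM /=; ring.
move=> k.
have /(congr1 (fun p : {poly A} => p`_w)) := term_deriv k.
rewrite coef_deriv !(coefB, coefD, coefCM, coefXderiv) e0 e1 e2 => E0.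
have {}E : (term k)`_w.+1 = i * (w.+1%:R * (term k)`_w.+1) by rewrite mulrA [i * _]mulrC iE mul1r.
rewrite {}E [_ * (term k)`__]mulrC mulr_natr E0.
rewrite !hornerE /=; ring.
Qed.


Lemma deform_term k : deform ('X_ord0 ^+ k * 'X_ord_max ^+ (k ^ 2)) = term k.
Proof. by rewrite deformM !rmorphXn /= deformX0 deformX1. Qed.

(** The polynomial f_d of the system, over any field of numbers; over R[i] it is fd2. *)
Definition alt_poly (d : nat) : A :=
  \sum_(k < d.+1)
    ((-1) ^+ k * 'C(d, k)%:R) *: ('X_ord0 ^+ k * 'X_ord_max ^+ (k ^ 2)).

(** The initial form of f_d has weight d and is herm d up to sign, because f_d
    is an alternating binomial sum over k of terms whose part of weight w has
    degree w in k. *)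
Lemma deform_alt_poly d : exists q : {poly A},
  deform (alt_poly d) = q * 'X^d /\ q`_0 = (-1) ^+ d * herm K d.
Proof.
have E w : (w <= d)%N -> exists P : {poly A}, [/\ (size P <= w.+1)%N,
   w`!%:R * P`_w = herm K w & (deform (alt_poly d))`_w = (-1) ^+ d * d`!%:R * P`_d].
  move=> wd; have [P [sP lP eP]] := term_coef w; exists P; split=> //.
  rewrite -alt_sum_poly; last exact: leq_trans sP _.
  rewrite rmorph_sum coef_sum; apply: eq_bigr => k _.
  rewrite /= deformZ deform_term coefCM eP mpolyCM mpolyC_nat rmorphXn rmorphN.
  by rewrite rmorph1.
exists (drop_poly d (deform (alt_poly d))); split; last first.
  have [//|P [sP lP eP]] := E d.
  by rewrite coef_drop_poly add0n eP -mulrA lP.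
apply: polyXn_dvd => w wd.
have [|P [sP _ ->]] := E w; first exact: ltnW.
by rewrite (nth_default 0) ?mulr0 // (leq_trans sP).
Qed.

End Initial.

(** * The ideal near the point *)

Section Local.
Variable K : numFieldType.
Local Notation A := {mpoly K[2]}.
Implicit Types (x y : A).
Local Notation ev := (meval (fun=> 1 : K)).
Local Notation u := (coord_u K).
Local Notation v := (coord_v K).

(** The polynomials without parts of weight less than N. *)
Definition weight_ge N x := exists r, deform x = r * 'X^N.

(** Multiplying by z^k shifts the weights, so the z^w-coefficient is the part
    of weight w - k, or zero if w < k. *)
Lemma deform_shift x k w :
  deform (deform x * 'X^k)`_w * 'X^k = ((deform x * 'X^k)`_w)%:P * 'X^w.
Proof.
rewrite coefMXn; case: ltnP => kw; first by rewrite rmorph0 !mul0r.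
by rewrite deform_coef -mulrA -exprD subnK.
Qed.

Variables (n : nat) (f g : A) (F G : {poly A}) (i j : nat).
Hypothesis fE : deform f = F * 'X^n.
Hypothesis gE : deform g = G * 'X^(n.+1).
Hypothesis F0 : F`_0 = (-1) ^+ i * herm K n.
Hypothesis G0 : G`_0 = (-1) ^+ j * herm K n.+1.

Lemma sign_sq k : (-1 : A) ^+ k * (-1) ^+ k = 1.
Proof. by rewrite -expr2 sqrr_sign. Qed.

(** herm_syz carried over to the initial forms, which differ from the Hermite
    polynomials by signs. *)
Lemma initial_syz a b : a * F`_0 + b * G`_0 = 0 ->
  exists e, a = G`_0 * e /\ b = - F`_0 * e.
Proof.
rewrite F0 G0 => E.
have [|e [aE bE]] := @herm_syz K n (a * (-1) ^+ i) (b * (-1) ^+ j).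
  by rewrite -E !mulrA.
exists ((-1) ^+ i * (-1) ^+ j * e); split.
  transitivity ((-1) ^+ i * (-1) ^+ i * a); first by rewrite sign_sq mul1r.
  transitivity ((-1) ^+ j * (-1) ^+ j * (a * (-1) ^+ i) * (-1) ^+ i); last by rewrite aE; ring.
  by rewrite (sign_sq j); ring.
transitivity ((-1) ^+ j * (-1) ^+ j * b); first by rewrite sign_sq mul1r.
transitivity ((-1) ^+ i * (-1) ^+ i * (b * (-1) ^+ j) * (-1) ^+ j); last by rewrite bE; ring.
by rewrite (sign_sq i); ring.
Qed.

(** The ideal (F, G) of A[z] is saturated with respect to z. If z x is in it,
    the constant terms of the coefficients form a syzygy of F(0), G(0), hence a
    trivial one; subtracting the same multiple of the trivial syzygy of F, G
    makes both coefficients divisible by z. *)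
Lemma saturated k (x a b : {poly A}) : x * 'X^k = a * F + b * G ->
  exists a' b', x = a' * F + b' * G.
Proof.
elim: k x a b => [|k IH] x a b; first by rewrite mulr1 => ->; exists a, b.
rewrite exprSr mulrA => E.
have E0 : a`_0 * F`_0 + b`_0 * G`_0 = 0.
  by have := congr1 (fun p : {poly A} => p`_0) E; rewrite coefMX coefD !coef0M.
have [e [aE bE]] := initial_syz E0.
have [a' a'E] : exists q, a - G * e%:P = q * 'X.
  by apply: polyX_dvd; rewrite coefB coefMC aE subrr.
have [b' b'E] : exists q, b + F * e%:P = q * 'X.
  by apply: polyX_dvd; rewrite coefD coefMC bE mulNr addNr.
apply: (IH _ a' b'); apply: (mulIf (negbT (polyX_eq0 A))); rewrite E.
transitivity ((a - G * e%:P) * F + (b + F * e%:P) * G); first by ring.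
by rewrite a'E b'E; ring.
Qed.

Definition in_ideal x := exists a b, x = a * f + b * g.

Lemma in_ideal0 : in_ideal 0.
Proof. by exists 0, 0; rewrite !mul0r addr0. Qed.
Lemma in_idealD x y : in_ideal x -> in_ideal y -> in_ideal (x + y).
Proof. by move=> [a [b ->]] [a' [b' ->]]; exists (a + a'), (b + b'); ring. Qed.
Lemma in_idealM x y : in_ideal y -> in_ideal (x * y).
Proof. by move=> [a [b ->]]; exists (x * a), (x * b); ring. Qed.
Lemma in_ideal_comb a b : in_ideal (a * f + b * g).
Proof. by exists a, b. Qed.

(** The initial form of h times a polynomial p is the value of h at the point
    times that of p. By saturation it lies in (F(0), G(0)), the ideal of
    two consecutive Hermite polynomials, which contains no nonzero polynomial
    of degree less than n. *)
Lemma stair_in_ideal h (s : 'rV[K]_(tri_num n)) : ev h != 0 -> in_ideal (h * stair s) -> s = 0.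
Proof.
move=> h1 [a [b E]]; apply: contrapT => /eqP s0.
have st0 : stair s != 0.
  apply: contra s0 => /eqP s0; apply/eqP.
  by apply: (@stair_herm K n s 0 0); rewrite s0 !mul0r addr0.
have exk : exists k, (deform (stair s))`_k != 0.
  apply: contrapT => nk; move/eqP: st0; apply; rewrite -[LHS]deform_at1.
  rewrite (_ : deform _ = 0) ?horner0 //; apply/polyP => k; rewrite coef0.
  by apply: contrapT => /eqP k0; apply: nk; exists k.
have [k k0 kmin] := ex_minnP exk.
(* q`_0 is the initial form of stair s, and k its weight. *)
pose q := drop_poly k (deform (stair s)).
have qE : deform (stair s) = q * 'X^k.
  apply: polyXn_dvd => w wk.
  by apply: contrapT => /eqP/kmin; rewrite leqNgt wk.
have q0 : q`_0 = (deform (stair s))`_k by rewrite coef_drop_poly.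
have [t tE _] := deform_stair s k.
have [|a' [b' E']] := @saturated k (deform h * q) (deform a * 'X^n) (deform b * 'X^(n.+1)).
  by rewrite -mulrA -qE -deformM E deformD !deformM fE gE; ring.
have := congr1 (fun p : {poly A} => p`_0) E'.
rewrite coefD !coef0M deform_coef0 q0 tE mul_mpolyC F0 G0 => /(congr1 (fun x => (ev h)^-1 *: x)).
rewrite scalerA mulVf // scale1r => tI.
have t0 : t = 0.
  apply: (@stair_herm K n t ((ev h)^-1 *: (a'`_0 * (-1) ^+ i)) ((ev h)^-1 *: (b'`_0 * (-1) ^+ j))).
  by rewrite tI scalerDr -!scalerAl !mulrA.
by move/eqP: k0; apply; rewrite tE t0 stair0.
Qed.

(** Decompose y by stair_span, keep from each summand the part of weight w, and
    replace the Hermite polynomials by the generators of which they are the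
    initial forms. *)
Lemma reduce_homog w y : deform y = y%:P * 'X^w ->
  exists (s : 'rV[K]_(tri_num n)) x r,
    [/\ y = stair s + x + r, in_ideal x, weight_ge w.+1 r & (2 * n <= w.+1)%N -> s = 0].
Proof.
move=> yw; have [s0 [a0 [b0 yE]]] := stair_span n y.
have [s sE s00] := deform_stair s0 w.
pose a := (deform a0 * 'X^n)`_w; pose b := (deform b0 * 'X^(n.+1))`_w.
have yE' : y = stair s + a * herm K n + b * herm K n.+1.
  have := congr1 (fun p : {poly A} => p`_w) yw; rewrite coefCM coefXn eqxx mulr1 => <-.
  rewrite yE !deformD !deformM !deform_herm !coefD sE; congr (_ + _ + _).
    by rewrite mulrCA coefCM mulrC.
  by rewrite mulrCA coefCM mulrC.
exists s, ((-1) ^+ i * a * f + (-1) ^+ j * b * g),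
  (y - stair s - (-1) ^+ i * a * f - (-1) ^+ j * b * g); split=> //.
- by ring.
- exact: in_ideal_comb.
have sgn k : deform ((-1) ^+ k) = ((-1) ^+ k)%:P.
  by rewrite rmorphXn rmorphN rmorph1 rmorphXn rmorphN rmorph1.
pose Q := y%:P - (stair s)%:P - ((-1) ^+ i * a)%:P * F - ((-1) ^+ j * b)%:P * G.
have [q qE] : exists q, Q = q * 'X.
  apply: polyX_dvd; rewrite coef0_comb F0 G0.
  transitivity (y - stair s - ((-1) ^+ i * (-1) ^+ i) * (a * herm K n)
    - ((-1) ^+ j * (-1) ^+ j) * (b * herm K n.+1)); first by ring.
  by rewrite !sign_sq {1}yE'; ring.
exists q; rewrite exprS mulrA -qE 3!deformB 4!deformM fE gE yw !sgn -sE deform_coef sE.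
have aE : deform a * 'X^n = a%:P * 'X^w by apply: deform_shift.
have bE : deform b * 'X^(n.+1) = b%:P * 'X^w by apply: deform_shift.
transitivity (y%:P * 'X^w - (stair s)%:P * 'X^w - ((-1) ^+ i)%:P * (deform a * 'X^n) * F
   - ((-1) ^+ j)%:P * (deform b * 'X^(n.+1)) * G); first by ring.
by rewrite aE bE /Q ![(_ * _)%:P]polyCM; ring.
Qed.

Lemma weight_geD N x y : weight_ge N x -> weight_ge N y -> weight_ge N (x + y).
Proof. by move=> [r rE] [r' rE']; exists (r + r'); rewrite deformD rE rE' mulrDl. Qed.

Lemma reduce N x : exists (s : 'rV[K]_(tri_num n)) y r,
  [/\ x = stair s + y + r, in_ideal y & weight_ge N r].
Proof.
elim: N => [|N [s [y [r [-> yI [r' rE]]]]]].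
  exists 0, 0, x; split; [by rewrite stair0 !add0r|exact: in_ideal0|by exists (deform x); rewrite mulr1].
have r0E : deform r'`_0 = (r'`_0)%:P * 'X^N.
  have <- : (deform r)`_N = r'`_0 by rewrite rE coefMXn ltnn subnn.
  exact: deform_coef.
have [s1 [y1 [r1 [E1 y1I r1v _]]]] := reduce_homog r0E.
exists (s + s1), (y + y1), (r1 + (r - r'`_0)); split.
- have -> : stair (s + s1) = stair s + stair s1.
    by have := stair_linear 1 s s1; rewrite !scale1r.
  by rewrite -[r in LHS](subrK r'`_0) {2}E1; ring.
- exact: in_idealD.
apply: weight_geD => //.
have [q qE] : exists q, r' - (r'`_0)%:P = q * 'X.
  by apply: polyX_dvd; rewrite coefB coefC subrr.
by exists q; rewrite deformB rE r0E exprS mulrA -qE mulrBl.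
Qed.



(** For k <= N these are monomials of weight 2N, and every monomial of larger
    weight is a proper multiple of one of them; with an odd weight in place of
    2N this would fail for the powers of v. *)
Definition weight_mon N k : A := u ^+ (2 * (N - k)) * v ^+ k.

Lemma weight_ge_mon N x : weight_ge (2 * N).+1 x ->
  exists c : 'I_N.+1 -> A, (forall k, ev (c k) = 0) /\ x = \sum_k c k * weight_mon N k.
Proof.
suff Q y : exists c : 'I_N.+1 -> A, (forall k, ev (c k) = 0) /\
    y - \sum_(w < (2 * N).+1) (deform y)`_w = \sum_k c k * weight_mon N k.
  move=> [r rE]; have [c [c0 cE]] := Q x; exists c; split=> //.
  rewrite -cE big1 ?subr0 // => w _.
  by rewrite rE coefMXn ltn_ord.
elim/(@uv_ind K): y => [x1 x2 [c [c0 cE]] [c' [c0' cE']]|a y [c [c0 cE]]|a b].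
- exists (fun k => c k + c' k); split=> [k|]; first by rewrite mevalD c0 c0' addr0.
  under [in RHS]eq_bigr do rewrite mulrDl.
  rewrite big_split /= -cE -cE'.
  under eq_bigr do rewrite deformD coefD.
  by rewrite big_split /=; ring.
- exists (fun k => a *: c k); split=> [k|]; first by rewrite mevalZ c0 mulr0.
  under [in RHS]eq_bigr do rewrite -scalerAl.
  rewrite -scaler_sumr -cE scalerBr scaler_sumr; congr (_ - _).
  by apply: eq_bigr => w _; rewrite deformZ coefCM mul_mpolyC.
have [lt|le] := ltnP (a + 2 * b) (2 * N).+1.
  exists (fun=> 0); split=> [k|]; first exact: meval0.
  rewrite [RHS]big1 => [|k _]; last exact: mul0r.
  rewrite (bigD1 (Ordinal lt)) //= big1 => [|w].
    by rewrite deform_mon coefCM coefXn eqxx mulr1 addr0 subrr.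
  by rewrite -val_eqE deform_mon coefCM coefXn /= => /negPf ->; rewrite mulr0.
have -> : \sum_(w < (2 * N).+1) (deform (u ^+ a * v ^+ b))`_w = 0.
  by apply: big1 => w _; rewrite deform_mon coefCM coefXn ltn_eqF ?mulr0 // (leq_trans (ltn_ord w)).
rewrite subr0.
have ev_mon r t : (0 < r + t)%N -> ev (u ^+ r * v ^+ t) = 0.
  rewrite mevalM !rmorphXn /= ev_u ev_v.
  by case: r t => [|r] [|t] //; rewrite !expr0n ?mulr0 ?mul0r.
(* The multiple of a monomial of weight 2N is proper since 2N < a + 2b. *)
have [k [kN [r [t [rt aE bE]]]]] : exists k, (k <= N)%N /\ exists r t,
   [/\ (0 < r + t)%N, a = (r + 2 * (N - k))%N & b = (t + k)%N].
  have [bN|Nb] := leqP b N.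
    by exists b; split=> //; exists (a - 2 * (N - b))%N, 0%N; split; lia.
  by exists N; split=> //; exists a, (b - N)%N; split; lia.
have kN1 : (k < N.+1)%N by [].
exists (fun l => if l == k :> nat then u ^+ r * v ^+ t else 0); split=> [l|].
  by case: eqP => _; rewrite ?meval0 // ev_mon.
rewrite (bigD1 (Ordinal kN1)) //= eqxx big1 ?addr0 => [|l].
  by rewrite /weight_mon aE bE !exprD; ring.
by rewrite -val_eqE /= => /negPf ->; rewrite mul0r.
Qed.

Lemma in_ideal_sum (I : finType) (X : I -> A) : (forall k, in_ideal (X k)) -> in_ideal (\sum_k X k).
Proof. by move=> IX; apply: big_ind => //; [exact: in_ideal0|exact: in_idealD]. Qed.

(** The determinant trick of Nakayama's lemma. The monomials Y of weight 2n
    satisfy Y = y + C Y with y in the ideal and C vanishing at the point, so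
    det (1 - C) multiplies them into the ideal. *)
Lemma weight_ge_in_ideal : exists h, ev h = 1 /\ forall r, weight_ge (2 * n).+1 r -> in_ideal (h * r).
Proof.
have /fin_all_exists[y] (k : 'I_n.+1) : exists y, in_ideal y /\ weight_ge (2 * n).+1 (weight_mon n k - y).
  have [|s [y [r [E yI rv s0]]]] := @reduce_homog (2 * n) (weight_mon n k).
    by rewrite deform_mon; congr (_ * 'X^_); have := ltn_ord k; lia.
  exists y; split=> //; rewrite E s0 // stair0 add0r addrC addKr //.
move=> yP.
have /fin_all_exists[C] (k : 'I_n.+1) : exists c : 'I_n.+1 -> A,
    (forall l, ev (c l) = 0) /\ weight_mon n k - y k = \sum_l c l * weight_mon n l.
  by apply: weight_ge_mon; case: (yP k).
move=> CP.
pose M : 'M[A]_n.+1 := 1%:M - \matrix_(k, l) C k l.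
pose Y : 'cV[A]_n.+1 := \col_k weight_mon n k.
have MY : M *m Y = \col_k y k.
  rewrite mulmxBl mul1mx; apply/colP => k; rewrite !mxE.
  under eq_bigr do rewrite !mxE.
  by case: (CP k) => _ <-; ring.
have gI (k : 'I_n.+1) : in_ideal (\det M * weight_mon n k).
  have : ((\det M)%:M *m Y) k 0 = \sum_l \adj M k l * y l.
    by rewrite -mul_adj_mx -mulmxA MY mxE; apply: eq_bigr => l _; rewrite [X in _ * X]mxE.
  rewrite mul_scalar_mx !mxE => ->; apply: in_ideal_sum => l; apply: in_idealM.
  by case: (yP l).
exists (\det M); split.
  rewrite -det_map_mx (_ : map_mx _ _ = 1%:M) ?det1 //.
  apply/matrixP => k l; rewrite !mxE rmorphB /= (CP k).1 subr0.
  by case: (k == l); rewrite ?meval1 ?meval0.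
move=> r /weight_ge_mon[c [_ ->]]; rewrite mulr_sumr; apply: in_ideal_sum => l.
by rewrite mulrCA; apply: in_idealM.
Qed.

Lemma weight_ge_exp x N : ev x = 0 -> weight_ge N (x ^+ N).
Proof.
move=> x0; have [q qE] : exists q, deform x = q * 'X.
  by apply: polyX_dvd; rewrite deform_coef0 x0 mpolyC0.
by exists (q ^+ N); rewrite rmorphXn /= qE exprMn.
Qed.

Lemma weight_geM N x y : weight_ge N y -> weight_ge N (x * y).
Proof. by move=> [r rE]; exists (deform x * r); rewrite deformM rE mulrA. Qed.

(** If e = 1 - s / s(1,1), then 1 - e^N is a multiple s q of s, and e^N has
    weight at least N; so x / s is q x up to terms of large weight, which the
    determinant of weight_ge_in_ideal absorbs. *)
Lemma stair_fraction x s : ev s != 0 ->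
  exists t h, ev h != 0 /\ in_ideal (h * (x - s * @stair K n t)).
Proof.
move=> s0; have [h [h1 hI]] := weight_ge_in_ideal.
pose e := 1 - ((ev s)^-1)%:MP * s.
have e0 : ev e = 0 by rewrite mevalB meval1 mevalM mevalC mulVf // subrr.
pose N := (2 * n).+1.
have [q qE] : exists q, e ^+ N = 1 - s * q.
  exists (((ev s)^-1)%:MP * \sum_(l < N) e ^+ l).
  rewrite -[LHS](subrK 1) subrX1 /e; ring.
have [t [y [r [E yI rv]]]] := reduce N (q * x).
exists t, h; split; first by rewrite h1 oner_neq0.
have -> : h * (x - s * stair t) = h * (x * e ^+ N) + h * s * y + s * (h * r).
  rewrite qE (_ : x * (1 - s * q) = x - s * (q * x)); last by ring.
  by rewrite E; ring.
apply: in_idealD; first apply: in_idealD; try exact: in_idealM.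
- by apply: hI; apply: weight_geM; apply: weight_ge_exp.
- by apply: in_idealM; apply: hI.
Qed.

End Local.

(** * Values near the point *)

Section Values.
Variable K : numFieldType.
Local Notation A := {mpoly K[2]}.
Local Notation ev := (meval (fun=> 1 : K)).

Lemma meval_bounded (p : A) : exists2 B : K, 0 <= B &
  forall q : 'I_2 -> K, (forall i, `|q i - 1| < 1) -> `|p.@[q]| <= B.
Proof.
elim/(@uv_ind K): p => [p1 p2 [B B0 PB] [B' B0' PB']|c p [B B0 PB]|a b].
- exists (B + B') => [|q q1]; first exact: addr_ge0.
  by rewrite mevalD (le_trans (ler_normD _ _)) // lerD ?PB ?PB'.
- exists (`|c| * B) => [|q q1]; first exact: mulr_ge0.
  by rewrite mevalZ normrM ler_wpM2l ?PB.
exists 1 => // q q1; rewrite mevalM !rmorphXn /= normrM !normrX /coord_u /coord_v.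
rewrite !mevalB !mevalXU meval1.
by apply: mulr_ile1; rewrite ?exprn_ge0 // exprn_ile1 // ltW.
Qed.

(** Continuity, in the form needed: h - h(1,1) is a combination of u and v, with
    coefficients bounded near the point. *)
Lemma meval_nonzero (h : A) : ev h != 0 -> exists2 e : K, 0 < e &
  forall q : 'I_2 -> K, (forall i, `|q i - 1| < e) -> h.@[q] != 0.
Proof.
move=> h0; have [a [b hE]] := taylor1 h.
have [Ba Ba0 aB] := meval_bounded a; have [Bb Bb0 bB] := meval_bounded b.
pose t := `|ev h|; have t0 : 0 < t by rewrite normr_gt0.
pose D := Ba + Bb + t; have D0 : 0 < D by rewrite ltr_wpDl ?addr_ge0.
exists (t / D) => [|q qe]; first exact: divr_gt0.
have q1 i : `|q i - 1| < 1.
  by rewrite (lt_le_trans (qe i)) // ler_pdivrMr // mul1r lerDr addr_ge0.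
rewrite hE !mevalD !mevalM mevalC /coord_u /coord_v !mevalB !mevalXU meval1.
apply/eqP => E.
suff : t < t by rewrite ltxx.
have {1}-> : t = `|(q ord0 - 1) * a.@[q] + (q ord_max - 1) * b.@[q]|.
  rewrite /t -normrN; congr `|_|; rewrite -[LHS]addr0 -E; ring.
apply: le_lt_trans (ler_normD _ _) _; rewrite !normrM.
apply: (@le_lt_trans _ _ (t / D * (Ba + Bb))).
  by rewrite mulrDr; apply: lerD; apply: ler_pM => //; [exact: ltW|exact: aB|exact: ltW|exact: bB].
by rewrite mulrAC ltr_pdivrMr // ltr_pM2l // ltrDl.
Qed.
End Values.

(** * The local ring and its dimension *)

Local Open Scope quotient_scope.

Section LocalDim.
Variables (K : fieldType) (A : comAlgType K) (ev : {rmorphism A -> K}).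
Variables (f g : A) (z : common_zero ev f g).
Local Notation P := (@point_ideal _ _ _ _ _ z : prime_idealr (coord_ring z)).
Local Notation pi := (\pi_{ideal_quot (gen_ideal z : idealr A)}).

Definition germ (x : A) : local_ring z := loc_frac (pi x : coord_ring z) (denom1 P).

Lemma pi_eq x y : pi x = pi y <-> exists a b, x - y = a * f + b * g.
Proof.
split=> [E|E].
  by apply/(gen_idealP z); rewrite Quotient.idealrBE; apply/eqP.
by apply/eqP; rewrite -Quotient.idealrBE; apply/(gen_idealP z).
Qed.

Lemma denom_ev h : (pi h : coord_ring z) \notin (P : {pred coord_ring z}) <-> ev h != 0.
Proof. by rewrite point_idealE. Qed.

(** Equality of fractions in the local ring, cleared of denominators: both the
    denominators and the multiplier from the definition of a localization are
    lifted to elements of A that do not vanish at the point. *)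
Lemma germ_eq (x y s : A) (t : loc_denom P) : sval t = pi s ->
  loc_frac (pi x : coord_ring z) t = germ y <->
  exists h, ev h != 0 /\ exists a b, h * (x - s * y) = a * f + b * g.
Proof.
move=> ts; rewrite /germ loc_fracP ts; split=> [[[t' tP]]|[h [h0 E]]].
  elim/quotW: t' tP => h hP /=; rewrite mulr1 -!rmorphM => /pi_eq E.
  exists h; split; first exact/denom_ev.
  by move: E; rewrite mulrBr [s * y]mulrC.
have hP : (pi h : coord_ring z) \notin (P : {pred coord_ring z}) by apply/denom_ev.
exists (exist (fun a => is_true (a \notin (P : {pred coord_ring z}))) _ hP) => /=.
rewrite mulr1 -!rmorphM; apply/pi_eq.
by rewrite [y * s]mulrC -mulrBr.
Qed.

Lemma germ_inj_eq x y : germ x = germ y <->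
  exists h, ev h != 0 /\ exists a b, h * (x - y) = a * f + b * g.
Proof.
by rewrite {1}/germ (@germ_eq x y 1) ?mul1r //= rmorph1.
Qed.

Lemma germ_linear : linear germ.
Proof.
move=> k x y.
have -> : k *: germ x = loc_frac (k *: pi x : coord_ring z) (denom1 P).
  exact: loc_scale_frac.
rewrite /germ loc_addE; apply/loc_fracP; exists (denom1 P) => /=.
rewrite rmorphD /= !mulr1; congr (_ * (_ + _)); exact: pi_scale.
Qed.

(** The hypotheses are the injectivity and the surjectivity of the map sending c
    to the germ of basis c, cleared of denominators by germ_eq. *)
Lemma local_ring_dim N (basis : 'rV[K]_N -> A) :
  linear basis ->
  (forall h c, ev h != 0 -> (exists a b, h * basis c = a * f + b * g) -> c = 0) ->
  (forall x s, ev s != 0 -> exists c h,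
     ev h != 0 /\ exists a b, h * (x - s * basis c) = a * f + b * g) ->
  inhabited (Vector.axiom N (local_ring z)).
Proof.
move=> lin inj surj.
pose psi c := germ (basis c).
have psi_lin : linear psi.
  by move=> k c d; rewrite /psi lin germ_linear.
have psi_inj : injective psi.
  move=> c d /germ_inj_eq[h [h0 E]]; apply/eqP; rewrite -subr_eq0; apply/eqP.
  case: E => a [b E]; apply: (inj h) => //; exists a, b; rewrite -E; congr (_ * _).
  by rewrite addrC -scaleN1r lin scaleN1r addrC.
have /choice[phi phiK] (x : local_ring z) : exists c, psi c = x.
  have [y [t ->]] := loc_fracE x.
  elim/quotW: y => y; have [s ts] : exists s, sval t = pi s.
    by exists (repr (sval t)); rewrite reprK.
  have [c [h [h0 E]]] : exists c h, ev h != 0 /\ exists a b, h * (y - s * basis c) = a * f + b * g.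
    by apply: surj; apply/denom_ev; rewrite -ts; apply: (valP t).
  by exists c; apply/esym/(germ_eq _ _ ts); exists h.
constructor; exists phi; last first.
  by exists psi => // c; apply: psi_inj.
by move=> k x y; apply: psi_inj; rewrite psi_lin !phiK.
Qed.

End LocalDim.

Theorem proposition7p6 (R : realType) (m : nat) (hm : (0 < m)%N) :
  multiplicity (fd2 R m.+1) (fd2 R m.+2) (fun=> 1%R) 'C(m + 2, 2).
Proof.
have [F [FE F0]] := deform_alt_poly R[i] m.+1.
have [G [GE G0]] := deform_alt_poly R[i] m.+2.
have sol : solution (fd2 R m.+1) (fd2 R m.+2) (fun=> 1%R).
  have ev0 d : meval (fun=> 1%R) (fd2 R d.+1) = 0.
    have [Q [QE _]] := deform_alt_poly R[i] d.+1.
    have := deform_coef0 (alt_poly R[i] d.+1); rewrite QE coefMXn /= => /esym/eqP.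
    by rewrite mpolyC_eq0 => /eqP.
  by split; apply: ev0.
split; last first.
  exists sol; have -> : 'C(m + 2, 2) = tri_num m.+1 by rewrite tri_numE addn2.
  apply: (@local_ring_dim _ _ _ _ _ sol _ (@stair R[i] m.+1)).
  - exact: stair_linear.
  - by move=> h c; apply: stair_in_ideal FE GE F0 G0 _ _.
  - by move=> x s; apply: (stair_fraction FE GE F0 G0).
split=> //.
have [h [h1 hI]] := weight_ge_in_ideal FE GE F0 G0.
have [|e e0 he] := @meval_nonzero R[i] h; first by rewrite h1 oner_neq0.
exists e => // q qe [fq gq].
have zero x : meval (fun=> 1) x = 0 -> meval q x = 0.
  move=> x0; have [a [b E]] := hI _ (weight_ge_exp (2 * m.+1).+1 x0).
  have : h.@[q] * x.@[q] ^+ (2 * m.+1).+1 = 0.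
    by rewrite -rmorphXn -mevalM E mevalD !mevalM fq gq !mulr0 addr0.
  by move/eqP; rewrite mulf_eq0 (negPf (he _ qe)) expf_eq0 => /andP[_ /eqP].
move=> i; have := zero ('X_i - 1); rewrite !mevalB !mevalXU !meval1 subrr => /(_ erefl) /eqP.
by rewrite subr_eq0 => /eqP.
Qed.
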